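(* For every digraph $F$ which is an orientation of a cactus graph, we have $\text{mader}_{\vec{\chi}}(F)=v(F)$.
   Context: Digraphs are finite, have a nonempty vertex set, are loopless and have no parallel arcs, but may contain anti-parallel pairs of arcs $(x,y),(y,x)$ (digons). $v(D)$ denotes the number of vertices of a digraph $D$. An orientation of a simple undirected graph $G$ is any digraph obtained by replacing each edge $\{u,v\}$ by exactly one of the arcs $(u,v),(v,u)$. A cactus graph is an undirected simple graph which does not contain a pair of (distinct) cycles sharing at least two vertices. An acyclic $k$-coloring of $D$ is a map $c:V(D)\to\{1,\dots,k\}$ such that each color class $c^{-1}(i)$ induces an acyclic subdigraph (one with no directed cycle; a digon is a directed cycle of length 2). The dichromatic number $\vec{\chi}(D)$ is the smallest $k\in\mathbb{N}$ for which $D$ has an acyclic $k$-coloring. A subdivision of a digraph $F$ is any digraph obtained by replacing every arc $(x,y)$ of $F$ by a directed path from $x$ to $y$ (of length at least 1), where the subdivision paths of different arcs are internally vertex-disjoint (and their internal vertices are new vertices). A digraph $D$ contains a subdivision of $F$ if some subdigraph of $D$ is isomorphic to a subdivision of $F$. $\text{mader}_{\vec{\chi}}(F)$ denotes the smallest integer $k\ge 1$ such that every digraph $D$ with $\vec{\chi}(D)\ge k$ contains a subdivision of $F$ (it is known that such a $k$ exists for every digraph $F$). *)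

(* Defs.v *)
From HB Require Import structures.
From mathcomp Require Import all_boot.
From mathcomp Require Import boolp.

Set Implicit Arguments.
Unset Strict Implicit.
Unset Printing Implicit Defensive.

Record digraph := Digraph {
  vert :> finType;
  darc : rel vert;
  darc_irrefl : irreflexive darc;
  vert_gt0 : 0 < #|vert|
}.

Record sgraph (T : finType) := SGraph {
  edge : rel T;
  edge_sym : symmetric edge;
  edge_irrefl : irreflexive edge
}.

Definition orientation (F : digraph) (G : sgraph F) : Prop :=
  (forall x y, edge G x y -> darc x y (+) darc y x) /\
  (forall x y : F, darc x y -> edge G x y).

Definition is_cycle (T : finType) (G : sgraph T) (c : seq T) : bool :=
  (2 < size c) && ucycleb (edge G) c.

(* A cycle is a subgraph, whereas a vertex sequence also records a starting
   point and a direction; two sequences describe the same cycle exactly when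
   they have the same edge set. *)
Definition cycle_edges (T : finType) (c : seq T) : {set {set T}} :=
  [set [set x; next c x] | x in c].

Definition cactus (T : finType) (G : sgraph T) : Prop :=
  forall c1 c2 : seq T, is_cycle G c1 -> is_cycle G c2 ->
    cycle_edges c1 <> cycle_edges c2 ->
    #|[set x in c1] :&: [set x in c2]| < 2.

(* Length 1 is excluded by irreflexivity; a digon gives length 2. *)
Definition is_dicycle (D : digraph) (c : seq D) : bool :=
  (0 < size c) && ucycleb (@darc D) c.

Definition acyclic_on (D : digraph) (A : {set D}) : Prop :=
  forall c : seq D, is_dicycle c -> ~ {subset c <= A}.

Definition acyclic_coloring (D : digraph) (k : nat) (c : D -> 'I_k) : Prop :=
  forall i : 'I_k, acyclic_on [set x | c x == i].

Definition acyclic_colorable (D : digraph) (k : nat) : Prop :=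
  exists c : D -> 'I_k, acyclic_coloring c.

Lemma acyclic_colorable_card (D : digraph) : acyclic_colorable D #|D|.
Proof.
exists enum_rank => i [|x [|y c]] //.
  by rewrite /is_dicycle /ucycleb /= darc_irrefl.
case/andP=> _ /andP[_] /= /andP[]; rewrite inE negb_or => /andP[xy _] _ sub.
have := sub x; have := sub y; rewrite !inE !eqxx orbT.
move=> /(_ isT) /eqP yi /(_ isT) /eqP xi.
by move/eqP: xy; apply; apply: enum_rank_inj; rewrite xi yi.
Qed.

Lemma acyclic_colorable_ex (D : digraph) :
  exists k, `[< acyclic_colorable D k >].
Proof. by exists #|D|; apply/asboolP; exact: acyclic_colorable_card. Qed.

Definition dichromatic (D : digraph) : nat := ex_minn (acyclic_colorable_ex D).

Definition diso (D1 D2 : digraph) : Prop :=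
  exists2 f : D1 -> D2, bijective f & forall x y, darc (f x) (f y) = darc x y.

Record subdigraph (D : digraph) := Subdigraph {
  sub_verts : {set D};
  sub_arcs : rel D;
  sub_verts_gt0 : 0 < #|sub_verts|;
  sub_arcsP : forall x y, sub_arcs x y ->
    [/\ x \in sub_verts, y \in sub_verts & darc x y]
}.

Section SubdigraphDigraph.
Variables (D : digraph) (H : subdigraph D).

Definition sub_vert : finType := {x : D | x \in sub_verts H}.
Definition sub_arc : rel sub_vert := fun x y => sub_arcs H (val x) (val y).

Lemma sub_arc_irrefl : irreflexive sub_arc.
Proof. by move=> x; apply/negP => /sub_arcsP[_ _]; rewrite darc_irrefl. Qed.

Lemma sub_vert_gt0 : 0 < #|sub_vert|.
Proof. by rewrite card_sig sub_verts_gt0. Qed.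

Definition digraph_of_sub : digraph := Digraph sub_arc_irrefl sub_vert_gt0.
End SubdigraphDigraph.
Coercion digraph_of_sub : subdigraph >-> digraph.

Definition arcs (F : digraph) : finType := {p : F * F | darc p.1 p.2}.

(* [subdivision F l] replaces each arc a = (x, y) of F by the path
     x -> (a, 0) -> (a, 1) -> ... -> (a, l a - 1) -> y
   with l a new internal vertices; the arc is kept when l a = 0. *)
Section Subdivision.
Variables (F : digraph) (l : arcs F -> nat).

Definition sd_vert : finType := (F + {a : arcs F & 'I_(l a)})%type.

Definition sd_arc : rel sd_vert := fun u w =>
  match u, w with
  | inl x, inl y => [exists a : arcs F, (val a == (x, y)) && (l a == 0)]
  | inl x, inr q => (x == (val (tag q)).1) && (tagged q == 0 :> nat)
  | inr p, inl y => (y == (val (tag p)).2) && ((tagged p).+1 == l (tag p))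
  | inr p, inr q => (tag p == tag q) && (tagged q == (tagged p).+1 :> nat)
  end.

Lemma sd_arc_irrefl : irreflexive sd_arc.
Proof.
case=> [x|p] /=; last by rewrite eqxx /= ltn_eqF.
apply/existsP => -[[[y z] /= yz] /andP[/eqP[ex ez] _]].
by move: yz; rewrite ex ez darc_irrefl.
Qed.

Lemma sd_vert_gt0 : 0 < #|sd_vert|.
Proof. by rewrite card_sum addn_gt0 vert_gt0. Qed.

Definition subdivision : digraph := Digraph sd_arc_irrefl sd_vert_gt0.
End Subdivision.

Definition contains_subdivision (D F : digraph) : Prop :=
  exists (H : subdigraph D) (l : arcs F -> nat), diso H (subdivision l).

Definition forces_subdivision (F : digraph) (k : nat) : Prop :=
  forall D : digraph, k <= dichromatic D -> contains_subdivision D F.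

(* [is_mader F k]: the Mader number of F exists and equals k. *)
Definition is_mader (F : digraph) (k : nat) : Prop :=
  [/\ 1 <= k, forces_subdivision F k &
      forall j, 1 <= j -> forces_subdivision F j -> k <= j].

(* Main.v *)
Require Import Defs.
From mathcomp Require Import all_boot.
From mathcomp Require Import boolp.

(* The key is a rooted statement: if [D - v] has an acyclic m-coloring
   but [D] has none, then every orientation d_0, ..., d_m of a cycle of length
   m + 1 has a subdivision in [D] rooted at [v].  To see this, start at [v] and
   explore color 0 in direction d_0, then color 1 in direction d_1, and so on
   up to color m - 1; from there continue in the constant direction d_m through
   unexplored vertices, the color increasing by one modulo m at each step.
   Increasing by one the color of every explored vertex creates no
   monochromatic cycle in [D - v]: each new color class splits into vertices of
   the first phase, of the second phase and unexplored ones, and arcs between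
   these parts cannot form a cycle.  So giving color 0 to [v] must create one
   through [v]; it contains an arc closing the desired cycle, and the steps of
   the second phase, all of direction d_m, are absorbed by the last segment.

   Given [W] with dichromatic number at least [#|X| + m], remove a maximal
   m-colorable set [A]; the rest contains a subdivision of [F[X]], and every
   vertex outside [A] roots a subdivided cycle in [A].  A cactus is obtained
   from one vertex by repeatedly attaching cycles or vertices at single
   vertices.  For the lower bound, the complete digraph on [#|F| - 1] vertices
   has too few vertices to contain a subdivision of [F]. *)

Set Implicit Arguments.
Unset Strict Implicit.
Unset Printing Implicit Defensive.

(** * Arcs with a direction flag, and predicates propagating along directed cycles *)

Definition oarc (D : digraph) (b : bool) : rel D :=
  fun x y => if b then darc x y else darc y x.

Lemma oarc_irrefl (D : digraph) b : irreflexive (@oarc D b).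
Proof. by move=> x; case: b; rewrite /oarc darc_irrefl. Qed.

(** Colors are natural numbers so that they can be shifted modulo [m] or offset by [k] without
    casts. *)
Definition colorable_on (D : digraph) (W : {set D}) (k : nat) : Prop :=
  exists2 c : D -> nat, (forall x, x \in W -> c x < k) &
    forall i, acyclic_on [set x in W | c x == i].

Lemma path_closed (T : eqType) (e : rel T) (P : T -> Prop) x s :
  path e x s -> (forall y z, y \in x :: s -> z \in x :: s -> e y z -> P y -> P z) ->
  P x -> forall y, y \in x :: s -> P y.
Proof.
elim: s x => [|z s IHs] x /=; first by move=> _ _ Px y; rewrite inE => /eqP->.
case/andP=> xz zs cl Px y; rewrite inE => /predU1P[->//|].
apply: (IHs z) => // [a b as_ bs|].
  by apply: cl; rewrite inE ?as_ ?bs orbT.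
by apply: cl xz Px; rewrite !inE eqxx ?orbT.
Qed.

(** Following the arcs of a cycle from [x] leads to every vertex of it. Closure against the arcs is
    closure of the complement along them, so the backward case reduces to the forward one. *)
Lemma dicycle_closed (D : digraph) (s : seq D) b (P : D -> Prop) :
  is_dicycle s ->
  (forall x y, x \in s -> y \in s -> oarc b x y -> P x -> P y) ->
  forall x y, x \in s -> y \in s -> P x -> P y.
Proof.
have forw (Q : D -> Prop) : is_dicycle s ->
  (forall x y, x \in s -> y \in s -> darc x y -> Q x -> Q y) ->
  forall x y, x \in s -> y \in s -> Q x -> Q y.
  case/and3P=> _ cyc _ cl x y xs ys Qx.
  case/rot_to: (xs) => i p sE.
  have memE z : (z \in x :: p) = (z \in s) by rewrite -sE mem_rot.
  have: cycle (@darc D) (x :: p) by rewrite -sE rot_cycle.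
  rewrite /= rcons_path => /andP[xp _].
  by apply: (path_closed xp) Qx _ _; rewrite ?memE // => a c; rewrite !memE; exact: cl.
move=> ds; case: b => /= cl x y xs ys; first exact: forw.
move=> Px; apply: contrapT => nPy.
apply: (forw (fun z => ~ P z) ds _ y x ys xs nPy Px).
by move=> a c as_ cs ac nPa Pc; apply: nPa; apply: cl ac Pc.
Qed.

Lemma dicycle_nbr (D : digraph) (s : seq D) b v :
  is_dicycle s -> v \in s -> exists2 x, x \in s & oarc b x v.
Proof.
case/and3P=> _ cyc _ vs; case: b.
  by exists (prev s v); rewrite ?mem_prev //; exact: prev_cycle.
by exists (next s v); rewrite ?mem_next //; exact: next_cycle.
Qed.

Lemma dicycle_nonempty (D : digraph) (s : seq D) : is_dicycle s -> exists x, x \in s.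
Proof. by case: s => // x s _; exists x; rewrite mem_head. Qed.

(** Used to show that a monochromatic cycle cannot mix the parts of a new color class. *)
Lemma dicycle_split (D : digraph) (s : seq D) b (P : D -> Prop) :
  is_dicycle s ->
  (forall x y, x \in s -> y \in s -> oarc b x y -> P x -> P y) ->
  (forall x, x \in s -> P x) \/ (forall x, x \in s -> ~ P x).
Proof.
move=> ds cl; have [[x xs Px]|nP] := pselect (exists2 x, x \in s & P x).
  by left=> y ys; apply: (dicycle_closed ds cl) Px.
by right=> x xs Px; apply: nP; exists x.
Qed.

(** * Subdivided cycles rooted at a critical vertex *)

Section RootedCycle.
Variables (D : digraph) (A : {set D}) (v : D) (m : nat) (c : D -> nat).
Variable d : nat -> bool.
Hypotheses (m_gt0 : 0 < m) (cm : forall x, x \in A -> c x < m).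
Hypothesis c_acyclic : forall i, acyclic_on [set x in A | c x == i].
Hypothesis v_critical : ~ colorable_on (v |: A) m.

(* Staying in color i uses the direction d_(i+1) of the next step: this makes
   the vertices reached in color i closed under d_(i+1)-arcs within that color,
   which [closing_arc] needs when d_(i+1) differs from d_m. *)
Inductive reached : nat -> D -> Prop :=
| reached_first x : x \in A -> c x = 0 -> oarc (d 0) v x -> reached 0 x
| reached_stay i x y : reached i x -> y \in A -> c y = i ->
    oarc (d i.+1) x y -> reached i y
| reached_next i x y : reached i x -> y \in A -> c y = i.+1 ->
    oarc (d i.+1) x y -> reached i.+1 y.

Lemma reachedP i x : reached i x -> x \in A /\ c x = i.
Proof. by case. Qed.

Definition in_reach x := reached (c x) x.

Lemma reached_in_reach i x : reached i x -> in_reach x.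
Proof. by move=> rx; rewrite /in_reach (reachedP rx).2. Qed.

Definition tail_step : rel D := fun x y =>
  [&& oarc (d m) x y, y \in A, c y == (c x).+1 %% m & ~~ `[< in_reach y >]].

Lemma tail_stepP x y : tail_step x y ->
  [/\ oarc (d m) x y, y \in A, c y = (c x).+1 %% m & ~ in_reach y].
Proof. by case/and4P=> xy yA /eqP cy /asboolP. Qed.

Definition tail_from s p := [/\ in_reach s, c s = m.-1 & path tail_step s p].

(** Requiring [p] nonempty leaves out the start [s], which belongs to the first phase, so the two
    phases are disjoint. *)
Definition in_tail x := exists s p, tail_from s p /\ p != [::] /\ last s p = x.

Lemma path_tail s p z : path tail_step s p -> z \in p -> z \in A /\ ~ in_reach z.
Proof.
elim: p s => //= y p IHp s; case/andP=> /tail_stepP[_ yA _ nry] yp.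
by rewrite inE => /predU1P[->//|]; exact: (IHp y yp).
Qed.

Lemma in_tailP x : in_tail x -> x \in A /\ ~ in_reach x.
Proof.
case=> s [p [[_ _ sp] [pN <-]]]; apply: (path_tail sp).
by case: p pN {sp} => //= y p _; rewrite mem_last.
Qed.

Lemma in_tail_step x y : in_tail x -> tail_step x y -> in_tail y.
Proof.
case=> s [p [[rs cs sp] [_ lx]]] xy; exists s, (rcons p y); split; last first.
  by rewrite last_rcons; case: (p).
by split=> //; rewrite rcons_path sp lx.
Qed.

Lemma in_tail_first x y : in_reach x -> c x = m.-1 -> tail_step x y -> in_tail y.
Proof. by move=> rx cx xy; exists x, [:: y]; rewrite /tail_from /= xy. Qed.

Definition moved x := in_reach x \/ in_tail x.

Lemma moved_in x : moved x -> x \in A.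
Proof. by case=> [/reachedP[]|/in_tailP[]]. Qed.

Definition shifted x :=
  if x == v then 0 else if `[< moved x >] then (c x).+1 %% m else c x.

Lemma closing_arc : exists s p, tail_from s p /\ oarc (d m) (last s p) v.
Proof.
apply: contrapT => no_arc; apply: v_critical; exists shifted => [x|i s ds s_sub].
  rewrite /shifted; case: eqP => //= xv; rewrite !inE => /orP[/eqP//|xA].
  by case: asboolP => _; [rewrite ltn_pmod | exact: cm].
have no_arc_moved b : moved b -> c b = m.-1 -> oarc (d m) b v -> False.
  case=> [rb cb bv|[s' [p [tl [_ lb]]]] _ bv]; apply: no_arc.
    by exists b, [::].
  by exists s', p; rewrite lb.
have memP x : x \in s -> x != v -> (moved x /\ (c x).+1 %% m = i) \/
     [/\ ~ moved x, x \in A & c x = i].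
  move=> /s_sub; rewrite !inE => /andP[/orP[->//|xA]].
  rewrite /shifted => /eqP + xv; rewrite (negPf xv).
  by case: asboolP => mx <-; [left | right].
have last_color x : x \in A -> (c x).+1 %% m = 0 -> c x = m.-1.
  move=> /cm; rewrite -{1}(prednK m_gt0) ltnS leq_eqVlt => /predU1P[//|lt].
  by rewrite modn_small // -(prednK m_gt0).
have prev_color j x : x \in A -> (c x).+1 %% m = j.+1 -> c x = j.
  move=> /cm; rewrite leq_eqVlt => /predU1P[->|lt]; first by rewrite modnn.
  by rewrite modn_small // => -[].
have vN : v \in s -> i = 0.
  by move/s_sub; rewrite inE /shifted eqxx => /andP[_ /eqP].
(* In class 0 a moved vertex has old color [m.-1], so a [d m]-arc from it to an unmoved vertex, of
   old color 0, would be a tail step. *)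
have step0 x y : i = 0 -> moved x -> x \in s -> x != v -> y \in s -> y != v ->
    oarc (d m) x y -> moved y.
  move=> i0 mx xs xv ys yv xy.
  have [[_]|[]//] := memP _ xs xv; rewrite i0 => /(last_color _ (moved_in mx)) cx.
  have [[]//|[nmy yA cy]] := memP _ ys yv.
  have st : tail_step x y.
    apply/and4P; split=> //; first by rewrite cy i0 cx prednK // modnn.
    by apply/asboolPn => ry; apply: nmy; left.
  case: mx => [rx|tx]; right; first exact: in_tail_first st.
  exact: in_tail_step st.
have vs : v \notin s.
  apply/negP => vs; have i0 := vN vs.
  have [b bs bv] := dicycle_nbr (d m) ds vs.
  have bNv : b != v by apply: contraTneq bv => ->; rewrite oarc_irrefl.
  have [[mb]|[nmb bA cb]] := memP _ bs bNv.
    by rewrite i0 => /(last_color _ (moved_in mb)); move/no_arc_moved: bv; apply.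
  (* If the directions differ, the arc between [b] and [v] read the other way reaches [b] at once.
     If they agree, [v] and the moved vertices are closed along the cycle, so [b] is moved. *)
  have [d0|dN0] := eqVneq (d 0) (d m); last first.
    apply: nmb; left; apply: (@reached_in_reach 0); apply: reached_first => //.
      by rewrite cb.
    by move: bv dN0; rewrite /oarc; case: (d 0); case: (d m).
  pose P x := x = v \/ moved x.
  suff: P b by case=> [bv'|/nmb//]; rewrite bv' eqxx in bNv.
  apply: (dicycle_closed ds (b := d m) _ vs bs); last by left.
  move=> x y xs ys xy Px; have [->|yNv] := eqVneq y v; first by left.
  right; have [xv|xNv] := eqVneq x v; last first.
    by case: Px => [/eqP|mx]; [rewrite (negPf xNv) | exact: (step0 x)].
  have [[]//|[nmy yA cy]] := memP _ ys yNv.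
  left; apply: (@reached_in_reach 0); apply: reached_first; rewrite // ?cy //.
  by rewrite d0 -xv.
have {}memP x : x \in s -> (moved x /\ (c x).+1 %% m = i) \/
     [/\ ~ moved x, x \in A & c x = i].
  by move=> xs; apply: memP => //; apply: contraNneq vs => <-.
have xNv x : x \in s -> x != v by move=> xs; apply: contraNneq vs => <-.
have mono j : (forall x, x \in s -> x \in A /\ c x = j) -> False.
  move=> sj; apply: (c_acyclic (i := j)) ds _ => x /sj[xA cx].
  by rewrite inE xA cx /=.
have unmoved : (forall x, x \in s -> ~ moved x) -> False.
  move=> nm; apply: (mono i) => x xs.
  by case: (memP x xs) => [[/nm]|[]].
case: i => [|j] in memP mono unmoved step0 s_sub vN *.
  have [|allm|//] := @dicycle_split _ s (d m) moved ds.
    by move=> x y xs ys xy mx; apply: (step0 x) => //; exact: xNv.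
  apply: (mono m.-1) => x xs; case: (memP x xs) => [[mx]|[/(_ (allm x xs))//]].
  by split; [exact: moved_in | apply: last_color => //; exact: moved_in].
have movedc x : x \in s -> moved x -> x \in A /\ c x = j.
  move=> xs mx; case: (memP x xs) => [[_ /prev_color]|[]//].
  by move/(_ (moved_in mx)) => ->; split=> //; exact: moved_in.
have reach_closed x y : x \in s -> y \in s -> oarc (d j.+1) x y -> in_reach x ->
    moved y.
  move=> xs ys xy rx; have [_ cx] := movedc x xs (or_introl rx).
  have [[]//|[_ yA cy]] := memP y ys.
  left; apply: (@reached_in_reach j.+1); apply: (reached_next (x := x)) => //.
  by rewrite -cx.
have tail_closed x y : x \in s -> y \in s -> oarc (d m) x y -> in_tail x ->
    ~ moved y -> in_tail y.
  move=> xs ys xy tx nmy; apply: (in_tail_step tx).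
  case: (memP y ys) => [[]//|[_ yA cy]].
  have [] := memP x xs; last by case=> -[]; right.
  by case=> _ cx; apply/and4P; split; rewrite ?cx ?cy //; apply/asboolPn => ry; apply: nmy; left.
(* With equal directions the closures of both phases combine into one for [moved]. *)
have [dj|dj] := eqVneq (d j.+1) (d m).
  have [|allm|//] := @dicycle_split _ s (d m) moved ds.
    move=> x y xs ys xy [rx|tx]; first by apply: (reach_closed x); rewrite ?dj.
    by apply: contrapT => nmy; apply: (nmy); right; apply: (tail_closed x).
  by apply: (mono j) => x xs; apply: movedc => //; exact: allm.
(* The directions are now opposite. A [d m]-arc from a tail vertex to a reached one, read backwards,
   would make the tail vertex reached through [reached_stay]. *)
have [|allt|not] := @dicycle_split _ s (d m) in_tail ds.
- move=> x y xs ys xy tx; apply: contrapT => nty.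
  have [[ry|//]|nmy] := pselect (moved y); last by apply: nty; exact: tail_closed tx nmy.
  have [xA nrx] := in_tailP tx; apply: nrx.
  have [_ cy] := movedc y ys (or_introl ry).
  have [_ cx] := movedc x xs (or_intror tx).
  rewrite /in_reach cx; apply: (reached_stay (x := y)) => //.
    by rewrite -cy.
  by move: xy dj; rewrite /oarc; case: (d m); case: (d j.+1).
- by apply: (mono j) => x xs; apply: movedc => //; right; exact: allt.
have [|allr|nor] := @dicycle_split _ s (d j.+1) in_reach ds.
- by move=> x y xs ys xy rx; case: (reach_closed x y) => // /(not y ys).
- by apply: (mono j) => x xs; apply: movedc => //; left; exact: allr.
by apply: unmoved => x xs [/(nor x xs)|/(not x xs)].
Qed.

(* [Y k] is the k-th branch vertex, [q k] lists the internal vertices of the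
   segment from [Y k] to [Y k.+1], and [t] those of the pending last segment. *)
Lemma reached_data i x : reached i x -> exists Y q t, [/\ Y 0 = v, q 0 = [::],
    forall k, k <= i -> path (oarc (d k)) (Y k) (rcons (q k) (Y k.+1)),
    forall k, k < i -> uniq (Y k.+1 :: q k.+1) /\
      {in Y k.+1 :: q k.+1, forall z, reached k z} &
    [/\ path (oarc (d i.+1)) (Y i.+1) t, last (Y i.+1) t = x,
       uniq (Y i.+1 :: t) & {in Y i.+1 :: t, forall z, reached i z}]].
Proof.
elim=> {i x} [x xA cx vx|i x y rx [Y [q [t [Y0 q0 Yq Yr [Yt lt ut rt]]]]] yA cy xy
             |i x y rx [Y [q [t [Y0 q0 Yq Yr [Yt lt ut rt]]]]] yA cy xy].
- exists (fun k => if k is 0 then v else x), (fun=> [::]), [::].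
  split=> //; first by case=> //= _; rewrite vx.
  split=> // z; rewrite inE => /eqP->; exact: reached_first.
- have pt : path (oarc (d i.+1)) (Y i.+1) (rcons t y) by rewrite rcons_path Yt lt.
  have rt' : {in Y i.+1 :: rcons t y, forall z, reached i z}.
    move=> z; rewrite -rcons_cons mem_rcons inE => /predU1P[->|]; last exact: rt.
    exact: reached_stay rx yA cy xy.
  (* The walk inside color [i] may revisit vertices; shortening it keeps its end [y]. *)
  have [t' [pt' ut' st' lt']] : exists t', [/\ path (oarc (d i.+1)) (Y i.+1) t',
      uniq (Y i.+1 :: t'), {subset t' <= rcons t y} & last (Y i.+1) t' = y].
    by case/shortenP: pt (last_rcons (Y i.+1) t y) => t' *; exists t'; split.
  exists Y, q, t'; split=> //; split=> // z; rewrite inE => /predU1P[->|/st' zt].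
    by apply: rt'; rewrite mem_head.
  by apply: rt'; rewrite inE zt orbT.
(* A new color makes [y] the branch vertex [i.+2] and closes [t] as segment [i.+1]. Color [k] owns
   index [k.+1] because index 0 is [v]. *)
- exists (fun k => if k == i.+2 then y else Y k), (fun k => if k == i.+1 then t else q k).
  exists [::]; split=> //.
  + move=> k; rewrite leq_eqVlt ltnS => /predU1P[->|ki].
      by rewrite !eqxx (ltn_eqF (ltnSn _)) rcons_path Yt lt.
    rewrite eqSS !ltn_eqF ?ltnS ?(leq_trans ki) //; exact: Yq.
  + move=> k; rewrite ltnS leq_eqVlt !eqSS => /predU1P[->|ki].
      by rewrite eqxx (ltn_eqF (ltnSn _)).
    by rewrite !ltn_eqF ?(leq_trans ki) //; exact: Yr.
  + rewrite eqxx /=; split=> // z; rewrite inE => /eqP->.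
    exact: reached_next rx yA cy xy.
Qed.

(** The block [Y k.+1 :: q k.+1] lies in the vertices reached in color [k], except that the last
    block ends with the tail, which avoids all reached vertices. Hence the blocks are disjoint. *)
Lemma rooted_cycle : exists Y q, [/\ Y 0 = v, Y m.+1 = v, q 0 = [::],
    forall k, k <= m -> path (oarc (d k)) (Y k) (rcons (q k) (Y k.+1)) &
    [/\ forall k, k < m -> uniq (Y k.+1 :: q k.+1),
       forall k, k < m -> {subset Y k.+1 :: q k.+1 <= A} &
       forall j k z, j < m -> k < m ->
         z \in Y j.+1 :: q j.+1 -> z \in Y k.+1 :: q k.+1 -> j = k]].
Proof.
have [s [p [[rs cs sp] bv]]] := closing_arc.
have [p' [{}sp up {}bv]] : exists p', [/\ path tail_step s p', uniq (s :: p') &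
    oarc (d m) (last s p') v].
  by case/shortenP: sp bv => p' *; exists p'.
move: rs; rewrite /in_reach cs => rs.
have [Y [q [t [Y0 q0 Yq Yr [Yt lt ut rt]]]]] := reached_data rs.
rewrite prednK // in Yt lt ut rt.
pose Y' k := if k == m.+1 then v else Y k.
(* The pending segment and the tail share the direction [d m], so they join into one segment. *)
pose q' k := if k == m then t ++ p' else q k.
have Y'E k : k <= m -> Y' k = Y k by move=> km; rewrite /Y' ltn_eqF.
have q'E k : k < m -> q' k = q k by move=> km; rewrite /q' ltn_eqF.
have Y'm : Y' m.+1 = v by rewrite /Y' eqxx.
have q'm : q' m = t ++ p' by rewrite /q' eqxx.
have block k : k < m -> k < m.-1 \/ k = m.-1.
  by rewrite -{1}(prednK m_gt0) ltnS leq_eqVlt => /predU1P[]; [right|left].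
have blockE k : k < m.-1 -> Y' k.+1 :: q' k.+1 = Y k.+1 :: q k.+1.
  move=> km; have k1 : k.+1 < m by rewrite -(prednK m_gt0) ltnS.
  by rewrite (Y'E _ (ltnW k1)) (q'E _ k1).
have blockm : Y' m :: q' m = (Y m :: t) ++ p' by rewrite q'm Y'E.
have tail z : z \in p' -> z \in A /\ ~ in_reach z by exact: (path_tail sp).
have block_reach k z : k < m -> z \in Y' k.+1 :: q' k.+1 ->
    reached k z \/ [/\ k = m.-1, z \in A & ~ in_reach z].
  case/block=> [km|->]; first by rewrite blockE // => /(Yr k km).2; left.
  rewrite prednK // blockm mem_cat => /orP[/rt|/tail[]]; first by left.
  by right.
exists Y', q'; split=> //.
- by rewrite q'E.
- move=> k; rewrite leq_eqVlt => /predU1P[->|km]; last first.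
    by rewrite !Y'E ?q'E // ?(ltnW km) //; apply: Yq; rewrite -ltnS prednK.
  rewrite q'm Y'm Y'E // rcons_path cat_path Yt last_cat lt bv andbT /=.
  by apply: sub_path sp => x y /tail_stepP[].
- split.
  + move=> k /block[km|->]; first by rewrite blockE //; exact: (Yr k km).1.
    have up' : uniq p' by case/andP: up.
    rewrite prednK // blockm cat_uniq ut up' andbT.
    by apply/hasPn => z /tail[_ nz]; apply/negP => /rt /reached_in_reach.
  + by move=> k km z /(block_reach k z km)[/reachedP[]|[]].
  + move=> j k z jm km /(block_reach j z jm)[rj|[-> _ nz]].
      case/(block_reach k z km)=> [rk|[_ _ nz]].
        by rewrite -(reachedP rj).2 (reachedP rk).2.
      by case: nz; exact: reached_in_reach rj.
    case/(block_reach k z km)=> [rk|[-> //]].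
    by case: nz; exact: reached_in_reach rk.
Qed.

End RootedCycle.

(** * Topological embeddings, forced vertex sets, and attaching a cycle *)

(** A subdivision of [F[X]] inside [D[W]]: [f] places the branch vertices and [p x y] lists the
    internal vertices of the path for the arc from [x] to [y]. *)
Definition embeds (F D : digraph) (X : {set F}) (W : {set D}) : Prop :=
  exists (f : F -> D) (p : F -> F -> seq D),
  [/\ {in X &, injective f}, {in X, forall x, f x \in W},
    forall x y, x \in X -> y \in X -> darc x y ->
      [/\ path (@darc D) (f x) (rcons (p x y) (f y)), uniq (p x y),
          {subset p x y <= W} & {in X, forall z, f z \notin p x y}] &
    forall x y x' y' z, x \in X -> y \in X -> darc x y ->
      x' \in X -> y' \in X -> darc x' y' ->
      z \in p x y -> z \in p x' y' -> x = x' /\ y = y'].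

(** The hypothesis on [W] says that the dichromatic number of [D[W]] is at least [#|X|]. *)
Definition forced (F : digraph) (X : {set F}) : Prop :=
  forall (D : digraph) (W : {set D}),
    (forall k, colorable_on W k -> #|X| <= k) -> embeds X W.

Lemma acyclic_on_sub (D : digraph) (A B : {set D}) :
  A \subset B -> acyclic_on B -> acyclic_on A.
Proof. by move=> /subsetP AB acB s ds sA; apply: (acB s ds) => x /sA /AB. Qed.

Lemma colorable_on0 (D : digraph) k : colorable_on (set0 : {set D}) k.
Proof.
exists (fun=> 0) => [x|i s ds ssub]; first by rewrite inE.
by have [x /ssub] := dicycle_nonempty ds; rewrite !inE.
Qed.

Lemma colorable_onU (D : digraph) (A B : {set D}) k l :
  colorable_on A k -> colorable_on B l -> colorable_on (A :|: B) (k + l).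
Proof.
case=> cA Ak acA [cB Bl acB].
exists (fun x => if x \in A then cA x else k + cB x) => [x|i].
  rewrite inE; case: ifP => [xA _|_ /= xB].
    by rewrite (leq_trans (Ak x xA)) ?leq_addr.
  by rewrite ltn_add2l Bl.
have [ik|ki] := ltnP i k.
  apply: acyclic_on_sub (acA i); apply/subsetP => x; rewrite !inE.
  by case: ifP => //= _ /andP[_ /eqP ix]; move: ik; rewrite -ix ltnNge leq_addr.
apply: acyclic_on_sub (acB (i - k)); apply/subsetP => x; rewrite !inE.
case: ifP => /= [xA /eqP ix|_ /andP[-> /eqP<-]]; last by rewrite addKn eqxx.
by move: ki; rewrite -ix leqNgt Ak.
Qed.

(** Makes every vertex of [W] outside [A] critical, as [rooted_cycle] requires of its root. *)
Lemma max_colorable (D : digraph) (W : {set D}) k :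
  exists A : {set D}, [/\ A \subset W, colorable_on A k &
    forall b, b \in W :\: A -> ~ colorable_on (b |: A) k].
Proof.
pose P (A : {set D}) := (A \subset W) && `[< colorable_on A k >].
have P0 : P set0 by rewrite /P sub0set; apply/asboolP/colorable_on0.
case: (arg_maxnP (fun A : {set D} => #|A|) P0) => A /andP[AW /asboolP Ak] maxA.
exists A; split=> // b; rewrite inE => /andP[bA bW] bAk.
have Pb : P (b |: A) by rewrite /P subUset sub1set bW AW; apply/asboolP.
by have := maxA _ Pb; rewrite /= cardsU1 bA ltnn.
Qed.

(* When [size s = 1] the cycle [u :: s] degenerates to a pendant vertex, and
   [arcsE] also allows it to be isolated. *)
Section AddCycle.
Variables (F : digraph) (X : {set F}) (u : F) (s : seq F).
Hypotheses (uX : u \in X) (s_gt0 : 0 < size s) (s_uniq : uniq s).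
Hypothesis sX : {in s, forall x, x \notin X}.
Hypothesis arcsE : forall x y, x \in X :|: [set z in s] ->
  y \in X :|: [set z in s] -> darc x y ->
  [\/ (x \in X) && (y \in X), (x \in u :: s) && (y == next (u :: s) x) |
      [&& y \in u :: s, x == next (u :: s) y & ~~ darc y x]].

Lemma us_uniq : uniq (u :: s).
Proof. by rewrite /= s_uniq andbT; apply: contraL uX; exact: sX. Qed.

(** The default [u] of [nth] accounts for the wrap-around at index [size s]. *)
Lemma nextE x : x \in u :: s -> next (u :: s) x = nth u s (index x (u :: s)).
Proof. by move=> xs; rewrite next_nth xs. Qed.

Lemma forced_add_cycle : forced X -> forced (X :|: [set x in s]).
Proof.
move=> forcedX D W Wcol.
have [A [AW [c cA acA] maxA]] := max_colorable W (size s).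
have [|f [p [f_inj fB fp p_dis]]] := forcedX D (W :\: A).
  move=> k Bk; have := Wcol (k + size s).
  rewrite cardsU disjoint_setI0; last first.
    by rewrite disjoint_sym disjoints_subset; apply/subsetP => x; rewrite !inE => /sX.
  rewrite cards0 subn0 cardsE (card_uniqP s_uniq) leq_add2r; apply.
  rewrite -(setID W A) (setIidPr AW) setUC; apply: colorable_onU => //.
  by exists c.
pose d k := darc (nth u (u :: s) k) (nth u s k).
have [Y [q [Y0 Ym q0 Yq [bu bA bdis]]]] :=
  rooted_cycle d s_gt0 cA acA (maxA _ (fB u uX)).
have ix z : z \in u :: s -> index z (u :: s) <= size s by rewrite -index_mem.
have inX z : z \in X -> z \in u :: s -> z = u.
  by move=> zX; rewrite inE => /predU1P[//|/sX]; rewrite zX.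
have ixs z : z \in s -> exists2 k, k < size s & index z (u :: s) = k.+1.
  move=> zs; exists (index z s); first by rewrite index_mem.
  by rewrite /=; case: eqP => // uz; move: (sX zs); rewrite -uz uX.
pose f' z := if z \in X then f z else Y (index z (u :: s)).
(* An arc against the cyclic order takes its segment reversed. Testing the forward reading first
   settles the case [size s = 1], where each vertex is the successor of the other. *)
pose p' x y := if (x \in X) && (y \in X) then p x y else
  if y == next (u :: s) x then q (index x (u :: s)) else rev (q (index y (u :: s))).
have f'us z : z \in u :: s -> f' z = Y (index z (u :: s)).
  rewrite /f' => zs; case: ifP => // zX; rewrite (inX z) //= eqxx Y0 //.
have f'nth k : k <= size s -> f' (nth u s k) = Y k.+1.
  rewrite leq_eqVlt => /predU1P[->|km].
    by rewrite nth_default // f'us ?mem_head //= eqxx Y0 Ym.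
  have sk : nth u s k \in s by exact: mem_nth.
  rewrite f'us ?inE ?sk ?orbT //=.
  by case: eqP => [uk|_]; [move: (sX sk); rewrite -uk uX | rewrite index_uniq].
have f's z : z \in s -> exists2 k, k < size s & index z (u :: s) = k.+1 /\ f' z = Y k.+1.
  move=> zs; have [k km iz] := ixs z zs; exists k => //; split=> //.
  by rewrite f'us ?iz // inE zs orbT.
have f'A z : z \in s -> f' z \in A.
  by case/f's=> k km [_ ->]; apply: bA km _ _; rewrite mem_head.
have f'X z : z \in X -> f' z \in W :\: A by rewrite /f' => zX; rewrite zX; exact: fB.
have disAB z : z \in A -> z \in W :\: A -> False by rewrite !inE => ->.
have qA k z : k <= size s -> z \in q k -> z \in A.
  case: k => [|k] km; first by rewrite q0.
  by move=> zk; apply: (bA k km); rewrite inE zk orbT.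
have q_uniq k : k <= size s -> uniq (q k).
  by case: k => [|k km]; [rewrite q0 | case/andP: (bu k km)].
have q_dis j k z : j <= size s -> k <= size s -> z \in q j -> z \in q k -> j = k.
  case: j k => [|j] [|k]; rewrite ?q0 // => jm km zj zk.
  by congr _.+1; apply: (bdis _ _ z); rewrite // inE ?zj ?zk orbT.
have Yq_dis j k : j < size s -> k <= size s -> Y j.+1 \notin q k.
  case: k => [|k] jm km; first by rewrite q0.
  apply/negP => Yk; have jk : j = k.
    by apply: (bdis _ _ (Y j.+1)); rewrite // ?mem_head // inE Yk orbT.
  by move: Yk; rewrite -jk => Yk; case/andP: (bu j jm); rewrite Yk.
(* Each new arc is carried by one segment [k]. The clause [~~ darc y x] ensures that [k] determines
   the arc, hence that paths of distinct arcs are disjoint. *)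
have newP x y : x \in X :|: [set z in s] -> y \in X :|: [set z in s] -> darc x y ->
    ~~ ((x \in X) && (y \in X)) -> exists2 k, k <= size s &
    (p' x y =i q k /\ path (@darc D) (f' x) (rcons (p' x y) (f' y)) /\ uniq (p' x y)) /\
    ((nth u (u :: s) k = x /\ nth u s k = y) \/
     [/\ nth u (u :: s) k = y, nth u s k = x & ~~ darc y x]).
  move=> xX' yX' xy nXX; rewrite /p' (negPf nXX).
  have [|] : [\/ x \in u :: s /\ y = next (u :: s) x |
      [/\ y \in u :: s, x = next (u :: s) y, y != next (u :: s) x & ~~ darc y x]].
    have := arcsE xX' yX' xy; rewrite (negPf nXX); case=> // [/andP[xs /eqP yE]|].
      by left.
    case/and3P=> ys /eqP xE nyx; have [yE|yN] := eqVneq y (next (u :: s) x).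
      by left; split; rewrite // xE mem_next.
    by right.
  - case=> xs yE; exists (index x (u :: s)); rewrite ?ix //.
    have km := ix _ xs; rewrite -yE eqxx; rewrite nextE // in yE.
    rewrite nth_index // -yE; split; last by left.
    split=> //; split; last exact: q_uniq.
    have := Yq _ km; rewrite /d nth_index // -yE xy.
    by rewrite f'us // yE f'nth.
  case=> ys xE yN nyx; exists (index y (u :: s)); rewrite ?ix //.
  have km := ix _ ys; rewrite nextE // in xE.
  rewrite (negPf yN) nth_index // -xE; split; last by right.
  split; first by move=> z; rewrite mem_rev.
  split; last by rewrite rev_uniq q_uniq.
  have := Yq _ km; rewrite /d nth_index // -xE (negPf nyx) -rev_path.
  rewrite last_rcons belast_rcons rev_cons.
  by rewrite -(f'nth _ km) -xE (f'us y ys).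
have old a b : a \in X -> b \in X -> darc a b ->
    [/\ p' a b = p a b, f' a = f a & f' b = f b].
  by move=> aX bX ab; rewrite /p' /f' aX bX.
have X'P z : z \in X :|: [set z in s] -> z \in X \/ z \in s.
  by rewrite !inE => /orP.
have WP z : z \in A \/ z \in W :\: A -> z \in W.
  by case=> [/(subsetP AW)//|]; rewrite inE => /andP[].
exists f', p'; split.
- move=> x y /X'P[xX|xs] /X'P[yX|ys] fxy.
  + by move: fxy; rewrite /f' xX yX; exact: f_inj.
  + by case: (disAB (f' y)); [exact: f'A | rewrite -fxy; exact: f'X].
  + by case: (disAB (f' x)); [exact: f'A | rewrite fxy; exact: f'X].
  have [j jm [xj fx]] := f's x xs; have [k km [yk fy]] := f's y ys.
  have [xus yus] : x \in u :: s /\ y \in u :: s by rewrite !inE xs ys !orbT.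
  rewrite -(nth_index u xus) -(nth_index u yus) xj yk; congr (nth _ _ _.+1).
  apply: (bdis j k (f' x) jm km).
    by rewrite fx mem_head.
  by rewrite fxy fy mem_head.
- by move=> z /X'P[zX|zs]; apply: WP; [right; exact: f'X | left; exact: f'A].
- move=> x y xX' yX' xy; have [/andP[xX yX]|nXX] := boolP ((x \in X) && (y \in X)).
    have [-> -> ->] := old x y xX yX xy; have [pp pu pW pf] := fp x y xX yX xy.
    split=> // [z /pW zW|z /X'P[zX|zs]]; first by apply: WP; right.
      by rewrite /f' zX; exact: pf.
    by apply/negP => /pW; apply: disAB; exact: f'A.
  have [k km [[pE [pp pu]] _]] := newP x y xX' yX' xy nXX.
  split=> // z; rewrite pE; first by move=> /(qA k z km) zA; apply: WP; left.
  case/X'P=> [zX|zs].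
    by apply/negP => /(qA k _ km) zA; apply: (disAB _ zA); exact: f'X.
  by have [j jm [_ ->]] := f's z zs; exact: Yq_dis.
- move=> x y x' y' z xX' yX' xy x'X' y'X' xy' zp zp'.
  have [/andP[xX yX]|nXX] := boolP ((x \in X) && (y \in X));
  have [/andP[x'X y'X]|nXX'] := boolP ((x' \in X) && (y' \in X)).
  + have [pE _ _] := old x y xX yX xy; have [pE' _ _] := old x' y' x'X y'X xy'.
    by apply: (p_dis x y x' y' z); rewrite // -?pE -?pE'.
  + have [pE _ _] := old x y xX yX xy; have [_ _ pW _] := fp x y xX yX xy.
    have [k km [[pE' _] _]] := newP x' y' x'X' y'X' xy' nXX'.
    by case: (disAB z); [apply: (qA k z km); rewrite -pE' | apply: pW; rewrite -pE].
  + have [pE _ _] := old x' y' x'X y'X xy'; have [_ _ pW _] := fp x' y' x'X y'X xy'.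
    have [k km [[pE' _] _]] := newP x y xX' yX' xy nXX.
    by case: (disAB z); [apply: (qA k z km); rewrite -pE' | apply: pW; rewrite -pE].
  have [k km [[pE _] ends]] := newP x y xX' yX' xy nXX.
  have [j jm [[pE' _] ends']] := newP x' y' x'X' y'X' xy' nXX'.
  have jk : j = k by apply: (q_dis j k z); rewrite // -?pE -?pE'.
  move: ends'; rewrite jk.
  case: ends => [[-> ->]|[-> -> nyx]].
    by case=> [[-> ->]//|[ex ey]]; rewrite -ex -ey xy.
  by case=> [[ex ey]|[-> ->]//]; move: nyx; rewrite ex ey xy'.
Qed.
End AddCycle.

(** * Building a cactus by attaching cycles and vertices *)

Section CactusGrowth.
Variables (F : digraph) (G : sgraph F).
Hypotheses (cactG : cactus G) (orG : orientation G).

(** Lets two cycles be told apart by a vertex lying on only one of them. *)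
Lemma cycle_edges_sub (c1 c2 : seq F) :
  cycle_edges c1 = cycle_edges c2 -> {subset c1 <= c2}.
Proof.
move=> eq12 x xc; have : [set x; next c1 x] \in cycle_edges c1 by exact: imset_f.
rewrite eq12 => /imsetP[z zc /setP/(_ x)]; rewrite !inE eqxx /=.
by case/esym/orP => /eqP->; rewrite ?mem_next.
Qed.

(* Otherwise [Q] together with an arc of [c] from [a] to [b] forms a second cycle
   through [a] and [b], with another vertex set. *)
Lemma cactus_ear (c Q : seq F) (a b : F) : is_cycle G c -> a \in c -> b \in c ->
  a != b -> path (edge G) a (rcons Q b) -> uniq Q -> {in Q, forall x, x \notin c} ->
  Q = [::] /\ (b = next c a \/ a = next c b).
Proof.
move=> cycc ac bc ab pQ uQ Qc; have /andP[c_gt2 /andP[cyc uc]] := cycc.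
have [i p1 p2 _ _ rc] := rot_to_arc uc ac bc ab.
have mem_c z : (z \in c) = (z \in a :: p1 ++ b :: p2) by rewrite -rc mem_rot.
have := uc; rewrite -(rot_uniq i) rc => urc.
have := cyc; rewrite -(rot_cycle i) rc /= rcons_cat cat_path /= => /and3P[pp1 p1b _].
(* The part [p2] of [c] from [b] back to [a] is replaced by the ear. *)
pose c2 := a :: p1 ++ b :: rev Q.
have cyc2 : cycle (edge G) c2.
  rewrite /= rcons_cat cat_path /= pp1 p1b /=.
  move: pQ; rewrite -rev_path last_rcons belast_rcons rev_cons.
  by congr path; apply/funext => x; apply/funext => y; rewrite edge_sym.
have c2E : c2 = (a :: rcons p1 b) ++ rev Q by rewrite /c2 -cat_rcons.
have urc1 : uniq (a :: rcons p1 b).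
  by move: urc; rewrite -cat_rcons -cat_cons cat_uniq => /and3P[].
have sub_c z : z \in a :: rcons p1 b -> z \in c.
  by rewrite mem_c -cat_rcons -cat_cons mem_cat => ->.
have uc2 : uniq c2.
  rewrite c2E cat_uniq urc1 rev_uniq uQ andbT; apply/hasPn => z.
  by rewrite mem_rev => /Qc; apply: contra; exact: sub_c.
have eq_edges : 2 < size c2 -> cycle_edges c = cycle_edges c2.
  move=> s2; apply: contrapT => neq.
  have : is_cycle G c2 by rewrite /is_cycle s2 /ucycleb cyc2.
  move/(cactG cycc)/(_ neq); rewrite ltnNge => /negP; apply.
  have <- : #|[set a; b]| = 2 by rewrite cards2 ab.
  apply/subset_leq_card/subsetP => z; rewrite !inE.
  by case/orP=> /eqP->; rewrite ?ac ?bc /= ?eqxx // mem_cat mem_head !orbT.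
have Q0 : Q = [::].
  case: Q => // x Q in pQ uQ Qc c2 cyc2 c2E uc2 eq_edges *.
  have /eq_edges eq2 : 2 < size c2 by rewrite c2E /= size_cat size_rcons size_rev /= addnS.
  have : x \in c2 by rewrite c2E mem_cat mem_rev mem_head orbT.
  by move/(cycle_edges_sub (esym eq2)); rewrite (negPf (Qc x (mem_head _ _))).
split=> //; rewrite -(next_rot i uc) -(next_rot i uc) rc.
(* If [p2] is empty, [a] follows [b] cyclically. Otherwise [p1] must be empty, since [c2] would be a
   cycle missing [y]. *)
case: p2 => [|y p2] in rc mem_c urc *.
  have bp1 : b \notin p1 by move: urc1; rewrite /= rcons_uniq => /and3P[].
  right; rewrite next_nth !inE mem_cat mem_head !orbT /= (negPf ab) index_cat (negPf bp1).
  by rewrite /= eqxx nth_default // size_cat addn0 addn1.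
case: p1 => [|x p1] in rc mem_c urc pp1 p1b c2 cyc2 c2E urc1 sub_c uc2 eq_edges *.
  by left; rewrite /= eqxx.
have /eq_edges eq2 : 2 < size c2 by rewrite c2E /= size_cat size_rcons.
have : y \in c by rewrite mem_c -cat_rcons -cat_cons mem_cat mem_head orbT.
move/(cycle_edges_sub eq2); rewrite c2E Q0 cats0.
by move: urc; rewrite -cat_rcons -cat_cons cat_uniq => /and3P[_ /hasPn/(_ y (mem_head _ _))/negP].
Qed.

Definition outer (X : {set F}) : rel F :=
  [rel x y | [&& edge G x y, x \notin X & y \notin X]].

(* Every component of G - X is attached to at most one vertex of X. *)
Definition attached_once (X : {set F}) : Prop := forall u u' y y',
  u \in X -> u' \in X -> y \notin X -> y' \notin X ->
  edge G u y -> edge G u' y' -> connect (outer X) y y' -> u = u'.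

Lemma outerC X : connect_sym (outer X).
Proof.
apply: sym_connect_sym => x y; rewrite /outer /= edge_sym.
by congr (_ && _); rewrite andbC.
Qed.

Lemma outer_sub (X Y : {set F}) x y : X \subset Y ->
  connect (outer Y) x y -> connect (outer X) x y.
Proof.
move=> /subsetP XY; apply: connect_sub => a b /and3P[ab aY bY].
apply: connect1; apply/and3P; split=> //.
  by apply: contra aY; exact: XY.
by apply: contra bY; exact: XY.
Qed.

Lemma path_outer (X : {set F}) y p : y \notin X -> path (outer X) y p ->
  path (edge G) y p /\ {in y :: p, forall z, z \notin X}.
Proof.
move=> yX py; split; first by apply: sub_path py => a b /and3P[].
apply: (path_closed py (P := fun z => z \notin X)) => //.
by move=> a b _ _ /and3P[].
Qed.

(** Turns a condition on edges into the arc condition of [forced_add_cycle]; the last clause holds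
    because an orientation has no digon. *)
Lemma orient_arcs (X : {set F}) u s :
  (forall x y, x \in X :|: [set z in s] -> y \in X :|: [set z in s] -> edge G x y ->
     [\/ (x \in X) && (y \in X), (x \in u :: s) && (y == next (u :: s) x) |
      (y \in u :: s) && (x == next (u :: s) y)]) ->
  forall x y, x \in X :|: [set z in s] -> y \in X :|: [set z in s] -> darc x y ->
     [\/ (x \in X) && (y \in X), (x \in u :: s) && (y == next (u :: s) x) |
      [&& y \in u :: s, x == next (u :: s) y & ~~ darc y x]].
Proof.
move=> edges x y xX yX xy; have exy := orG.2 _ _ xy.
have := orG.1 _ _ exy; rewrite xy /= => nyx.
by case: (edges x y xX yX exy) => [?|?|/andP[ys xE]];
  [constructor 1 | constructor 2 | constructor 3; rewrite ys xE].
Qed.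

(** Serves for a pendant vertex at [u] and for one without neighbor in [X]. The separation
    hypothesis keeps any outer component from being attached both to [y] and to [X]. *)
Lemma grow_vertex (X : {set F}) u y : u \in X -> y \notin X -> attached_once X ->
  (forall x, x \in X -> edge G x y -> x = u) ->
  (forall y1 y2 x, x \in X -> y1 \notin y |: X -> y2 \notin y |: X ->
    edge G y y1 -> edge G x y2 -> connect (outer X) y1 y2 -> False) ->
  forced X -> forced (y |: X) /\ attached_once (y |: X).
Proof.
move=> uX yX onceX yu sep forcedX.
have uy : u != y by apply: contraNneq yX => <-.
have XE : y |: X = X :|: [set z in [:: y]].
  by apply/setP => z; rewrite !inE orbC.
split.
  rewrite XE; apply: (@forced_add_cycle _ _ u) => //.
    by move=> x; rewrite inE => /eqP->.
  apply: orient_arcs => a b; rewrite !inE.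
  case/orP=> [aX|/eqP->] /orP[bX|/eqP->] ab.
  - by constructor 1; rewrite aX bX.
  - by constructor 2; rewrite (yu a) //= !eqxx.
  - by constructor 3; rewrite (yu b) /= ?eqxx // edge_sym.
  - by rewrite edge_irrefl in ab.
have sub : X \subset y |: X by exact: subsetUr.
have out z : z \notin y |: X -> z \notin X by rewrite !inE negb_or => /andP[].
move=> u1 u2 y1 y2 /setU1P[->|u1X] /setU1P[->|u2X] y1X y2X e1 e2 con //.
- by case: (sep y1 y2 u2) => //; exact: outer_sub con.
- by case: (sep y2 y1 u1) => //; rewrite outerC; exact: outer_sub con.
by apply: onceX e1 e2 _; rewrite ?out //; exact: outer_sub con.
Qed.

(** The path lies in one outer component, so [u] is its only neighbor in [X]. A chord of the cycle,
    or an outer path joining two of its vertices, would be an ear excluded by [cactus_ear]. *)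
Lemma grow_cycle (X : {set F}) u y p : u \in X -> y \notin X -> attached_once X ->
  edge G u y -> path (outer X) y p -> uniq (y :: p) -> p != [::] ->
  edge G u (last y p) -> forced X ->
  forced (X :|: [set z in y :: p]) /\ attached_once (X :|: [set z in y :: p]).
Proof.
move=> uX yX onceX uy py up pN ul forcedX; pose s := y :: p.
have [eyp sX] := path_outer yX py.
have ys z : z \in s -> connect (outer X) y z by exact: path_connect.
have us : u \notin s by apply: contraL uX; exact: sX.
have cyc : is_cycle G (u :: s).
  rewrite /is_cycle /ucycleb /= uy rcons_path eyp edge_sym ul.
  by case: (p) pN up us => //= ? ? _ -> ->.
have csX z : z \in u :: s -> z \in X :|: [set z in s].
  by rewrite !inE => /orP[/eqP->|->]; rewrite ?uX ?orbT.
have X'P z : z \in X :|: [set z in s] -> z \in X \/ z \in s by rewrite !inE => /orP.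
have memcs z : z \in s -> z \in u :: s by move=> zs; rewrite inE zs orbT.
have foot x z : x \in X -> z \in s -> edge G x z -> x = u.
  by move=> xX zs xz; apply: (onceX x u z y) => //; [exact: sX | rewrite outerC; exact: ys].
split.
  apply: (@forced_add_cycle _ _ u) => //; apply: orient_arcs => a b aX bX ab.
  have [_|nab] := boolP ((a \in X) && (b \in X)); first by constructor 1.
  have [ac bc] : a \in u :: s /\ b \in u :: s.
    have [aX'|as_] := X'P a aX; have [bX'|bs] := X'P b bX.
    - by rewrite aX' bX' in nab.
    - by rewrite (foot a b) // mem_head memcs.
    - by rewrite (foot b a) ?mem_head ?memcs // edge_sym.
    - by rewrite !memcs.
  have aNb : a != b by apply: contraTneq ab => ->; rewrite edge_irrefl.
  have pab : path (edge G) a (rcons [::] b) by rewrite /= ab.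
  have [|_ [->|->]] := cactus_ear cyc ac bc aNb pab isT; first by [].
  - by constructor 2; rewrite ac eqxx.
  - by constructor 3; rewrite bc eqxx.
have sub : X \subset X :|: [set z in s] by exact: subsetUl.
have out z : z \notin X :|: [set z in s] -> z \notin X /\ z \notin s.
  by rewrite !inE negb_or => /andP[].
have foot' u1 u2 y1 y2 : u1 \in s -> u2 \in X -> y1 \notin X -> y2 \notin X ->
    edge G u1 y1 -> edge G u2 y2 -> connect (outer X) y1 y2 -> u2 = u.
  move=> u1s u2X y1X y2X e1 e2 con; apply: (onceX u2 u y2 y) => //.
  rewrite outerC (connect_trans (ys u1 u1s)) // (connect_trans _ con) //.
  by apply: connect1; apply/and3P; rewrite e1 y1X sX.
move=> u1 u2 y1 y2 u1X u2X y1X y2X e1 e2 con.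
have [y1o y1s] := out _ y1X; have [y2o y2s] := out _ y2X.
have conX := outer_sub sub con.
have [/andP[u1X' u2X']|nX] := boolP ((u1 \in X) && (u2 \in X)).
  exact: onceX e1 e2 conX.
have [u1c u2c] : u1 \in u :: s /\ u2 \in u :: s.
  have [u1X'|u1s] := X'P u1 u1X; have [u2X'|u2s] := X'P u2 u2X.
  - by rewrite u1X' u2X' in nX.
  - by rewrite (foot' u2 u1 y2 y1) ?mem_head ?memcs // outerC.
  - by rewrite (foot' u1 u2 y1 y2) ?mem_head ?memcs.
  - by rewrite !memcs.
apply/eqP; apply: contraT => u12.
case/connectP: con => q; case/shortenP => q' pq' uq' _ lq'.
have [eq' q'X] := path_outer y1X pq'.
have [|z zq|//] := @cactus_ear (u :: s) (y1 :: q') u1 u2 cyc u1c u2c u12 _ uq' _.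
  by rewrite /= e1 rcons_path eq' -lq' edge_sym.
by apply: contra (q'X z zq); exact: csX.
Qed.

(** Induction on the complement. If no edge leaves [X], any vertex is added. If [u] has two
    neighbors in one outer component, a simple path between them closes a cycle; otherwise a
    neighbor of [u] is pendant. *)
Lemma cactus_forced_from (X : {set F}) : X != set0 -> attached_once X ->
  forced X -> forced [set: F].
Proof.
have [n] := ubnP #|~: X|; elim: n X => // n IHn X leX X0 onceX forcedX.
have [XT|/subsetPn[y0 _ y0X]] := boolP ([set: F] \subset X).
  by have -> : [set: F] = X by apply/eqP; rewrite eqEsubset XT subsetT.
have step (Y : {set F}) y : y \in Y -> y \notin X -> X \subset Y ->
    forced Y /\ attached_once Y -> forced [set: F].
  move=> yY yX XY [fY aY]; apply: IHn aY fY.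
    rewrite -ltnS (leq_trans _ leX) // ltnS proper_card // properEneq setCS XY andbT.
    by apply: contraNneq yX => /setC_inj<-.
  by apply/set0Pn; exists y.
have [/existsP[u /existsP[y /and3P[uX yX uy]]]|noedge] :=
    boolP [exists u, exists y, [&& u \in X, y \notin X & edge G u y]]; last first.
  have none x z : x \in X -> z \notin X -> edge G x z -> False.
    move=> xX zX xz; case/negP: noedge.
    by apply/existsP; exists x; apply/existsP; exists z; rewrite xX zX.
  have [u uX] := set0Pn _ X0.
  apply: (step (y0 |: X) y0); rewrite ?setU11 ?subsetUr //.
  apply: (grow_vertex uX) => // [x xX xy0|y1 y2 x xX _ y2X _ xy2 _].
    by case: (none x y0).
  by case: (none x y2) => //; apply: contra y2X => y2X; rewrite inE y2X orbT.
have [/existsP[y' /and4P[y'X uy' yy' con]]|nocycle] :=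
    boolP [exists y', [&& y' \notin X, edge G u y', y != y' & connect (outer X) y y']].
  case/connectP: con uy' yy' => q; case/shortenP => p py up _ -> ul yl.
  apply: (step (X :|: [set z in y :: p]) y); rewrite ?subsetUl //.
    by rewrite !inE eqxx orbT.
  apply: (grow_cycle uX yX) => //.
  by apply: contraNneq yl => ->.
apply: (step (y |: X) y); rewrite ?setU11 ?subsetUr //.
apply: (grow_vertex uX) => // [x xX xy|y1 y2 x xX y1X y2X yy1 xy2 con].
  by apply: onceX xy uy _.
have out z : z \notin y |: X -> z \notin X /\ z != y.
  by rewrite !inE negb_or => /andP[].
have [[y1o _] [y2o y2y]] := (out _ y1X, out _ y2X).
have yy2 : connect (outer X) y y2.
  by apply: connect_trans con; apply: connect1; apply/and3P; rewrite yy1 yX.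
(* Then [y2] is a second neighbor of [u] in the component of [y], the case already excluded. *)
have xu : u = x by exact: onceX uy xy2 yy2.
case/negP: nocycle; apply/existsP; exists y2.
by rewrite y2o xu xy2 eq_sym y2y.
Qed.

Lemma forced1 (x0 : F) : forced [set x0].
Proof.
move=> D W Wcol; have [W0|[w wW]] := set_0Vmem W.
  by have := Wcol 0; rewrite W0 cards1 => /(_ (colorable_on0 _ _)).
exists (fun=> w), (fun _ _ => [::]); split=> //.
- by move=> x y; rewrite !inE => /eqP-> /eqP->.
- by move=> x y; rewrite !inE => /eqP-> /eqP->; rewrite darc_irrefl.
Qed.

Lemma cactus_forced : forced [set: F].
Proof.
have /card_gt0P[x0 _] := vert_gt0 F.
apply: (@cactus_forced_from [set x0]); last exact: forced1.
  by apply/set0Pn; exists x0; rewrite set11.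
by move=> u u' y y'; rewrite !inE => /eqP-> /eqP->.
Qed.

End CactusGrowth.

(** * From embeddings to subdivisions *)

Lemma diso_image (D S : digraph) (g : S -> D) : injective g ->
  (forall u w, darc u w -> darc (g u) (g w)) -> exists H : subdigraph D, diso H S.
Proof.
move=> g_inj g_arc; pose V := [set g u | u in [set: S]].
(* Only images of arcs are kept, since [D] may have further arcs between the image vertices. *)
pose E x y := [exists u, exists w, [&& g u == x, g w == y & darc u w]].
have VE u : g u \in V by exact: imset_f.
have V_gt0 : 0 < #|V| by rewrite card_imset // cardsT vert_gt0.
have EP x y : E x y -> [/\ x \in V, y \in V & darc x y].
  case/existsP=> u /existsP[w /and3P[/eqP<- /eqP<- /g_arc uw]].
  by rewrite !VE.
pose H := Subdigraph V_gt0 EP; exists H.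
pose h u : H := exist (fun x => x \in V) (g u) (VE u).
have h_inj : injective h by move=> u w /(congr1 val) /g_inj.
have [|h' hK h'K] := inj_card_bij h_inj.
  by rewrite card_sig card_imset // cardsT.
exists h'; first by exists h.
move=> x y; rewrite -(h'K x) -(h'K y) !hK /darc /= /sub_arc /=.
apply/idP/existsP => [uw|[u /existsP[w /and3P[/eqP/g_inj-> /eqP/g_inj-> //]]]].
by exists (h' x); apply/existsP; exists (h' y); rewrite !eqxx.
Qed.

Lemma embeds_contains (F D : digraph) :
  embeds [set: F] [set: D] -> contains_subdivision D F.
Proof.
case=> f [p [f_inj _ fp p_dis]].
pose P (a : arcs F) := p (val a).1 (val a).2.
pose l a := size (P a).
have arcP (a : arcs F) : [/\ path (@darc D) (f (val a).1) (rcons (P a) (f (val a).2)),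
    uniq (P a) & forall z, f z \notin P a].
  have [pp pu _ pf] := fp _ _ (in_setT _) (in_setT _) (valP a).
  by split=> // z; exact: pf.
have P_dis a b z : z \in P a -> z \in P b -> a = b.
  move=> za zb; apply: val_inj.
  have [] := p_dis _ _ _ _ z (in_setT _) (in_setT _) (valP a)
    (in_setT _) (in_setT _) (valP b) za zb.
  by case: (val a) (val b) => ? ? [? ?] /= -> ->.
have stepP (a : arcs F) i : i <= l a ->
    darc (nth (f (val a).1) (f (val a).1 :: P a) i)
         (nth (f (val a).1) (rcons (P a) (f (val a).2)) i).
  move=> il; have [/(pathP (f (val a).1)) step _ _] := arcP a.
  have := step i; rewrite size_rcons ltnS => /(_ il).
  by rewrite -rcons_cons nth_rcons /= ltnS il.
pose g (x : subdivision l) : D := match x with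
  | inl y => f y
  | inr q => nth (f (val (tag q)).1) (P (tag q)) (tagged q)
  end.
have gP (a : arcs F) (i : 'I_(l a)) : g (inr (Tagged _ i)) \in P a.
  exact: mem_nth.
suff [H isoH] : exists H : subdigraph D, diso H (subdivision l) by exists H, l.
apply: (@diso_image _ _ g).
- move=> [x|[a i]] [y|[b j]] gxy.
  + by congr inl; apply: f_inj.
  + by have [_ _ /(_ x)/negP[]] := arcP b; move: (gP b j); rewrite -gxy.
  + by have [_ _ /(_ y)/negP[]] := arcP a; move: (gP a i); rewrite gxy.
  have ab : a = b.
    by apply: P_dis (gP a i) _; rewrite [g _]gxy; exact: gP.
  subst b; congr (inr (existT _ a _)); apply/val_inj/eqP.
  have [_ pu _] := arcP a.
  by rewrite -(nth_uniq (f (val a).1) _ _ pu) ?ltn_ord //; apply/eqP.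
move=> [x|[a i]] [y|[b j]]; rewrite {1}/darc /=.
- case/existsP=> a /andP[/eqP aE /eqP la].
  have := @stepP a 0 isT; rewrite /= aE /=.
  by move: la; rewrite /l; case: (P a).
- case/andP=> /eqP-> /eqP j0; have := ltn_ord j; rewrite j0 => lt0.
  by have := @stepP b 0 isT; rewrite nth_rcons lt0.
- case/andP=> /eqP-> /eqP il; have := @stepP a (l a) (leqnn _).
  by rewrite nth_rcons ltnn eqxx -[in nth _ (_ :: _) _]il.
case/andP=> /eqP ab /eqP ji; subst b.
have := @stepP a j (ltnW (ltn_ord j)); rewrite nth_rcons ltn_ord.
by rewrite [X in nth _ (_ :: _) X]ji.
Qed.

(** * Dichromatic number, complete digraphs and the final bounds *)

Lemma colorable_onT (D : digraph) k :
  colorable_on [set: D] k -> acyclic_colorable D k.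
Proof.
case=> c ck ac; have ck' x : c x < k by exact: ck.
exists (fun x => Ordinal (ck' x)) => i; apply: acyclic_on_sub (ac i).
by apply/subsetP => x; rewrite !inE -val_eqE.
Qed.

Lemma dichromatic_le (D : digraph) k : acyclic_colorable D k -> dichromatic D <= k.
Proof.
by move=> Dk; rewrite /dichromatic; case: ex_minnP => n _; apply; exact/asboolP.
Qed.

Section CompleteDigraph.
Variables (n : nat) (n_gt0 : 0 < n).

Definition complete_arc : rel 'I_n := fun x y => x != y.

Lemma complete_arc_irrefl : irreflexive complete_arc.
Proof. by move=> x; rewrite /complete_arc eqxx. Qed.

Lemma complete_gt0 : 0 < #|'I_n|. Proof. by rewrite card_ord. Qed.

Definition complete_digraph := Digraph complete_arc_irrefl complete_gt0.

Lemma dichromatic_complete : n <= dichromatic complete_digraph.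
Proof.
rewrite /dichromatic; case: ex_minnP => k /asboolP[c ac] _.
suff /leq_card : injective c by rewrite !card_ord.
move=> x y cxy; apply/eqP; apply: contraT => xy.
(* Two distinct vertices of the complete digraph form a digon, so they cannot share a color. *)
case: (ac (c x) [:: x; y]).
  by rewrite /is_dicycle /ucycleb /= /complete_arc inE xy eq_sym xy.
by move=> z; rewrite !inE => /orP[]/eqP->; rewrite ?cxy.
Qed.

End CompleteDigraph.

Lemma contains_subdivision_card (D F : digraph) : contains_subdivision D F -> #|F| <= #|D|.
Proof.
case=> H [l [h /bij_eq_card HS _]].
apply: (@leq_trans #|H|); first by rewrite HS /= card_sum leq_addr.
by have := max_card (mem (sub_verts H)); rewrite -card_sig.
Qed.

Theorem corollary8 (F : digraph) (G : sgraph F) :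
  cactus G -> orientation G -> is_mader F #|F|.
Proof.
move=> cactG orG; split=> [|D chiD|j j_gt0 forcesj]; first exact: vert_gt0.
  apply/embeds_contains/(cactus_forced cactG orG) => k /colorable_onT Dk.
  by rewrite cardsT (leq_trans chiD) ?dichromatic_le.
rewrite leqNgt; apply/negP => jF.
(* From [1 <= j < #|F|] the complete digraph on [#|F|.-1] vertices is nonempty, and its dichromatic
   number is at least [j]. *)
have n_gt0 : 0 < #|F|.-1
  by rewrite -ltnS prednK ?vert_gt0 // (leq_ltn_trans j_gt0 jF).
have /forcesj/contains_subdivision_card : j <= dichromatic (complete_digraph n_gt0).
  apply: leq_trans (dichromatic_complete n_gt0).
  by rewrite -ltnS prednK // vert_gt0.
by rewrite card_ord leqNgt prednK ?vert_gt0 // leqnn.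
Qed.
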